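(* For every integer $t\ge 2$, the complete $3$-uniform hypergraph $H=K^{(3)}_{3(t-1)}$ on $3(t-1)$ vertices does not contain $K_t$ as a minor and has chromatic number $\chi(H)=\left\lceil\frac{3}{2}(t-1)\right\rceil$. Thus, denoting by $h(t)$ the largest chromatic number of a hypergraph that does not contain $K_t$ as a minor, we have $h(t)\ge\left\lceil\frac{3}{2}(t-1)\right\rceil$.
   Context: A hypergraph is a pair $H=(V,E)$ with $V=V(H)$ a finite set and $E=E(H)$ a set of subsets of $V$ (hyperedges), each of size at least $2$. Graphs are the hypergraphs all of whose hyperedges have size exactly $2$; $K_t$ is the complete graph on $t$ vertices. The complete $3$-uniform hypergraph $K_n^{(3)}$ has $n$ vertices and its hyperedges are exactly all $3$-element subsets of the vertex-set. Subhypergraph: $H_1\subseteq H_2$ if $V(H_1)\subseteq V(H_2)$ and $E(H_1)\subseteq E(H_2)$. Contraction: for $e\in E(H)$ and a new vertex $v\notin V(H)$, let $\phi:V(H)\to (V(H)\setminus e)\cup\{v\}$ be the identity on $V(H)\setminus e$ and constantly $v$ on $e$. Then $H/e$ has vertex-set $(V(H)\setminus e)\cup\{v\}$ and hyperedge-set $\{\phi(f)\mid f\in E(H),\ f\not\subseteq e\}$. Minor: $H_2$ is a minor of $H_1$ if a hypergraph isomorphic to $H_2$ can be obtained from $H_1$ by a finite sequence of operations, each being either moving to a subhypergraph or contracting a hyperedge. Coloring: a set of vertices is independent in $H$ if it contains no hyperedge as a subset. A proper coloring of $H$ is a map $c:V(H)\to S$ all of whose color classes are independent; $\chi(H)$ is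 the minimum size of a color set $S$ admitting a proper coloring. *)

(* Defs.v *)
From mathcomp Require Import all_boot all_order all_algebra.
From mathcomp Require classical_sets.

Set Implicit Arguments.
Unset Strict Implicit.
Unset Printing Implicit Defensive.

Record hypergraph := Hypergraph {
  vertex :> finType;
  hyperedges : {set {set vertex}};
  hyperedge_size : forall e, e \in hyperedges -> 1 < #|e|
}.

Lemma complete_hyperedge_size (r n : nat) (r_gt1 : 1 < r) (e : {set 'I_n}) :
  e \in [set f : {set 'I_n} | #|f| == r] -> 1 < #|e|.
Proof. by rewrite inE => /eqP ->. Qed.

Definition complete_hypergraph (r : nat) (r_gt1 : 1 < r) (n : nat) : hypergraph :=
  Hypergraph (@complete_hyperedge_size r n r_gt1).

Definition K (t : nat) : hypergraph := @complete_hypergraph 2 isT t.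

Definition K3 (n : nat) : hypergraph := @complete_hypergraph 3 isT n.

Definition isomorphic (H1 H2 : hypergraph) : Prop :=
  exists2 f : H1 -> H2, bijective f &
    forall e : {set H1}, (f @: e \in hyperedges H2) = (e \in hyperedges H1).

Section Operations.

Variable H : hypergraph.

(* The subhypergraph of H with vertex set W and hyperedge set F.  The vertex
   set W is turned into a type, so hyperedges of F not contained in W
   disappear; when F is a set of hyperedges of H contained in W, nothing is
   lost, and so every subhypergraph of H is of this form. *)
Definition sub_hyperedges (W : {set H}) (F : {set {set H}}) :
    {set {set {x : H | x \in W}}} :=
  [set f : {set {x : H | x \in W}} | val @: f \in F :&: hyperedges H].

Lemma sub_hyperedge_size W F f : f \in sub_hyperedges W F -> 1 < #|f|.
Proof.
rewrite !inE => /andP[_ /hyperedge_size].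
by rewrite card_imset //; exact: val_inj.
Qed.

Definition subhypergraph (W : {set H}) (F : {set {set H}}) : hypergraph :=
  Hypergraph (@sub_hyperedge_size W F).

(* The vertex set of H / e is (V(H) \ e) + {v}, with None as the new vertex v;
   contract_map is the map phi, insub sending x outside e to itself and
   x in e to None. *)
Definition contract_map (e : {set H}) (x : H) : option {x : H | x \notin e} :=
  insub x.

Definition contract_hyperedges (e : {set H}) :
    {set {set option {x : H | x \notin e}}} :=
  [set contract_map e @: f | f : {set H} in hyperedges H & ~~ (f \subset e)].

Lemma contract_hyperedge_size e g : g \in contract_hyperedges e -> 1 < #|g|.
Proof.
case/imsetP=> f; rewrite inE => /andP[fE fe] ->{g}.
have [x xf xe] := subsetPn fe.
have : 0 < #|f :\ x| by have := hyperedge_size fE; rewrite (cardsD1 x f) xf.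
case/card_gt0P=> y; rewrite !inE => /andP[yx yf].
apply/card_gt1P; exists (contract_map e x), (contract_map e y).
split; rewrite ?imset_f //.
rewrite /contract_map (insubT (fun x => x \notin e) xe).
case: insubP => [u _ uy|//]; apply: contra_neq yx => -[xu].
by rewrite -uy -xu.
Qed.

Definition contract (e : {set H}) : hypergraph :=
  Hypergraph (@contract_hyperedge_size e).

End Operations.

Inductive obtained_from (H : hypergraph) : hypergraph -> Prop :=
| obtained_refl : obtained_from H H
| obtained_sub (G : hypergraph) (W : {set G}) (F : {set {set G}}) :
    obtained_from H G -> obtained_from H (subhypergraph W F)
| obtained_contract (G : hypergraph) (e : {set G}) :
    obtained_from H G -> e \in hyperedges G -> obtained_from H (contract e).

Definition minor (H2 H1 : hypergraph) : Prop :=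
  exists2 G : hypergraph, obtained_from H1 G & isomorphic H2 G.

Definition independent (H : hypergraph) (A : {set H}) : bool :=
  [forall e in hyperedges H, ~~ (e \subset A)].

Definition proper_coloring (H : hypergraph) (S : finType) (c : H -> S) : bool :=
  [forall s : S, independent [set x : H | c x == s]].

Definition colorable (H : hypergraph) (k : nat) : bool :=
  [exists c : {ffun H -> 'I_k}, proper_coloring c].

Lemma colorable_card (H : hypergraph) : exists k, colorable H k.
Proof.
exists #|H|; apply/existsP; exists [ffun x => enum_rank x].
apply/forallP=> s; apply/forall_inP=> e /hyperedge_size /card_gt1P[x [y]].
case=> xe ye; apply: contraNN => /subsetP sub_e.
move: (sub_e x xe) (sub_e y ye); rewrite !inE !ffunE => /eqP <- /eqP.
by move/enum_rank_inj ->.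
Qed.

Definition chromatic_number (H : hypergraph) : nat := ex_minn (colorable_card H).

Definition is_largest_chromatic_number (t m : nat) : Prop :=
  (exists2 H : hypergraph, ~ minor (K t) H & chromatic_number H = m) /\
  (forall H : hypergraph, ~ minor (K t) H -> chromatic_number H <= m).

(* xget 0 P is an element satisfying P if there is one, and 0 otherwise. *)
Definition h (t : nat) : nat :=
  classical_sets.xget 0 (is_largest_chromatic_number t).

(* Main.v *)
Require Import Defs.
From mathcomp Require Import all_boot all_order all_algebra.
From mathcomp Require boolp classical_sets.
From mathcomp Require Import zify lra.

(** A minor of a hypergraph whose hyperedges all have at least 3 vertices
    still carries the sizes of the sets of vertices merged into each of its
    vertices, and these sizes alone exclude K_t: each size is 1 or at least 3,
    since a contraction merges a whole hyperedge, and every hyperedge of the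
    minor has total size at least 3.  In a minor K_t two
    vertices of size 1 would form an edge of total size 2, so at most one size
    is 1 and the host has at least 1 + 3(t-1) vertices
    ([complete_minor_order]).  A proper colouring of the complete 3-uniform
    hypergraph is a colouring using every colour at most twice
    ([colorable_complete]), so its chromatic number is half its order, rounded
    up.

    The inequality for [h t] requires that the maximum defining [h t] exist,
    that is, that hypergraphs without a K_t minor have bounded chromatic
    number ([chromatic_number_bound]).  This is shown by reduction to graphs.
    Keep only the inclusion-minimal hyperedges and split the vertex set
    greedily into connected 2-colourable parts, each one maximal among the
    vertices that remain.  By maximality, a hyperedge that leaves a part can be
    replaced by one that leaves it at a single vertex
    ([one_vertex_extension]), so that every hyperedge is bichromatic in the
    2-colourings of the parts or meets two parts joined by a hyperedge inside
    their union.  It then suffices to colour the graph of parts; this graph is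
    2^t-colourable or has a K_t minor, by induction on t along distance layers
    ([model_or_colouring]), and a K_t minor of it is one of the hypergraph,
    obtained by contracting hyperedges inside the branch sets
    ([minor_branch_sets]). *)

(** * Connected sets of vertices and links between them *)

Section Connectivity.
Set Implicit Arguments.
Unset Strict Implicit.
Unset Printing Implicit Defensive.

Variable T : finType.
Implicit Types (E P Q : {set {set T}}) (A B S U W X Y Z e f : {set T}).

Definition splits S X : bool := (X :&: S != set0) && ~~ (X \subset S).

(** Connectedness is stated through cuts, so that it passes to unions and to
    contractions by moving the cut alone. *)
Definition connected_in E X : bool :=
  (X != set0) &&
  [forall S : {set T}, splits S X ==>
     [exists f in E, (f \subset X) && splits S f]].

(** A link of two disjoint sets is exactly a hyperedge that becomes an edge
    between them once each is contracted to a vertex. *)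
Definition link E S U : bool :=
  [exists f in E, [&& f \subset S :|: U, f :&: S != set0 & f :&: U != set0]].

Lemma splitsP S X :
  reflect (exists x y, [/\ x \in X, y \in X, x \in S & y \notin S])
          (splits S X).
Proof.
apply: (iffP andP) => [[/set0Pn[x /setIP[xX xS]] /subsetPn[y yX yS]]|].
  by exists x, y.
move=> [x [y [xX yX xS yS]]]; split; last by apply/subsetPn; exists y.
by apply/set0Pn; exists x; rewrite inE xX.
Qed.

Lemma linkP E S U :
  reflect (exists f x y, [/\ f \in E, f \subset S :|: U,
                             (x \in f) && (x \in S) & (y \in f) && (y \in U)])
          (link E S U).
Proof.
apply: (iffP exists_inP) => [[f fE /and3P[fSU /set0Pn[x] + /set0Pn[y]]]|].
  by rewrite !inE => xP yP; exists f, x, y.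
move=> [f [x [y [fE fSU xP yP]]]]; exists f => //; apply/and3P; split=> //.
  by apply/set0Pn; exists x; rewrite inE.
by apply/set0Pn; exists y; rewrite inE.
Qed.

Lemma connected_edge E X S x y :
    connected_in E X -> x \in X -> y \in X -> x \in S -> y \notin S ->
  exists2 f, f \in E & (f \subset X) && splits S f.
Proof.
move=> /andP[_ /forallP/(_ S)/implyP cX] xX yX xS yS.
by apply/exists_inP/cX/splitsP; exists x, y.
Qed.

Lemma connected_nonempty E X : connected_in E X -> exists x, x \in X.
Proof. by case/andP=> /set0Pn. Qed.

Lemma connected_set1 E x : connected_in E [set x].
Proof.
apply/andP; split; first by apply/set0Pn; exists x; rewrite inE.
apply/forallP=> S; apply/implyP=> /splitsP[u [v [/set1P-> /set1P->]]].
by move=> ->.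
Qed.

Lemma link_sym E S U : link E S U = link E U S.
Proof.
by apply/linkP/linkP=> -[f [x [y [fE fSU xP yP]]]]; exists f, y, x;
  rewrite setUC.
Qed.

Lemma linkS E E' S S' U U' :
    E \subset E' -> S \subset S' -> U \subset U' ->
  link E S U -> link E' S' U'.
Proof.
move=> sE sS sU /linkP[f [x [y [fE fSU /andP[xf xS] /andP[yf yU]]]]].
apply/linkP; exists f, x, y; split; first exact: (subsetP sE).
- exact: subset_trans fSU (setUSS sS sU).
- by rewrite xf (subsetP sS).
- by rewrite yf (subsetP sU).
Qed.

Lemma connectedS E E' X :
  E \subset E' -> connected_in E X -> connected_in E' X.
Proof.
move=> sE /andP[X0 /forallP cX]; rewrite /connected_in X0 /=.
apply/forallP=> S; apply/implyP=> /(implyP (cX S))/exists_inP[f fE fP].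
by apply/exists_inP; exists f => //; exact: (subsetP sE).
Qed.

(** A set splitting the union either splits one of the two connected sets or
    separates them, and is then crossed by the hyperedge linking them. *)
Lemma connectedU E X Y :
    connected_in E X -> connected_in E Y -> link E X Y ->
  connected_in E (X :|: Y).
Proof.
move=> cX cY /linkP[f [x [y [fE fXY /andP[xf xX] /andP[yf yY]]]]].
apply/andP; split; first by apply/set0Pn; exists x; rewrite inE xX.
apply/forallP=> S; apply/implyP=> spl; apply/exists_inP.
have inX u v : u \in X -> v \in X -> u \in S -> v \notin S ->
    exists2 g, g \in E & (g \subset X :|: Y) && splits S g.
  move=> uX vX uS vS; have [g gE /andP[gX sg]] := connected_edge cX uX vX uS vS.
  by exists g; rewrite // sg (subset_trans gX) ?subsetUl.
have inY u v : u \in Y -> v \in Y -> u \in S -> v \notin S ->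
    exists2 g, g \in E & (g \subset X :|: Y) && splits S g.
  move=> uX vX uS vS; have [g gE /andP[gX sg]] := connected_edge cY uX vX uS vS.
  by exists g; rewrite // sg (subset_trans gX) ?subsetUr.
have fin : (x \in S) != (y \in S) ->
    exists2 g, g \in E & (g \subset X :|: Y) && splits S g.
  move=> xy; exists f; rewrite // fXY /=; apply/splitsP.
  by case xS: (x \in S) xy; case yS: (y \in S) => // _;
    [exists x, y | exists y, x]; rewrite xS yS.
have [//|] := boolP ((x \in S) == (y \in S)); last by move/fin.
move=> /eqP xyS; case/splitsP: spl => u [v [uXY vXY uS vS]].
case xS: (x \in S).
  have yS : y \in S by rewrite -xyS.
  by case/setUP: vXY => [vX|vY]; [exact: (inX x v)|exact: (inY y v)].
have yS : y \notin S by rewrite -xyS xS.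
by case/setUP: uXY => ?; [apply: (inX u x)|apply: (inY u y)]; rewrite ?xS.
Qed.

(** Unlike in a graph, the vertices of [e] outside [X] need not be joined to
    [X] one at a time, so this is not an instance of [connectedU]. *)
Lemma connectedU_edge E X e x :
  connected_in E X -> e \in E -> x \in e -> x \in X ->
  connected_in E (X :|: e).
Proof.
move=> cX eE xe xX; apply/andP; split.
  by apply/set0Pn; exists x; rewrite inE xX.
apply/forallP=> S; apply/implyP=> /splitsP[u [v [uXe vXe uS vS]]].
apply/exists_inP.
have in_e a b : a \in e -> b \in e -> a \in S -> b \notin S ->
    exists2 g, g \in E & (g \subset X :|: e) && splits S g.
  move=> ae be aS bS; exists e; rewrite // subsetUr /=.
  by apply/splitsP; exists a, b.
have in_X a b : a \in X -> b \in X -> a \in S -> b \notin S ->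
    exists2 g, g \in E & (g \subset X :|: e) && splits S g.
  move=> aX bX aS bS; have [g gE /andP[gX sg]] := connected_edge cX aX bX aS bS.
  by exists g; rewrite // sg (subset_trans gX) ?subsetUl.
case xS: (x \in S).
  by case/setUP: vXe => ?; [exact: (in_X x v)|exact: (in_e x v)].
by case/setUP: uXe => ?; [apply: (in_X u x)|apply: (in_e u x)]; rewrite ?xS.
Qed.

Lemma connectedU_bigcup E B P :
    connected_in E B ->
    (forall X, X \in P -> connected_in E X && link E B X) ->
  connected_in E (B :|: cover P).
Proof.
move=> cB HP; rewrite /cover.
have : all (fun X => connected_in E X && link E B X) (enum P).
  by apply/allP=> X; rewrite mem_enum => /HP.
rewrite -big_enum; elim: (enum P) => [|X s IH] /= => [_|].
  by rewrite big_nil setU0.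
case/andP=> /andP[cX lX] /IH cs; rewrite big_cons setUCA setUC.
apply: connectedU => //; apply: linkS lX => //.
exact: subsetUl.
Qed.

(** * Splitting the vertices into connected 2-colourable parts *)

(** The 2-colouring is the set [A] of vertices of the first colour, and a
    hyperedge is bichromatic when [A] splits it. *)
Definition two_colourable E X : bool :=
  [exists A : {set T}, [forall f in E, (f \subset X) ==> splits A f]].

(** The set [A] is the union of the first colour classes of the parts.  Adding
    to it a colouring of [P] that is proper along links makes every hyperedge
    inside [W] bichromatic. *)
Definition two_colourable_partition E W P A : Prop :=
  [/\ cover P = W, trivIset P, forall X, X \in P -> connected_in E X &
   forall e, e \in E -> e \subset W ->
     splits A e \/
     exists X Y, [/\ X \in P, Y \in P, X != Y, link E X Y &
        (e :&: X != set0) && (e :&: Y != set0)]].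

Definition is_clutter E : Prop :=
  forall e f, e \in E -> f \in E -> e \subset f -> e = f.

Lemma splits_eq S S' X : (forall x, x \in X -> (x \in S) = (x \in S')) ->
  splits S X -> splits S' X.
Proof.
move=> SS' /splitsP[x [y [xX yX xS yS]]].
by apply/splitsP; exists x, y; rewrite -!SS'.
Qed.

(** Among the hyperedges that meet [X] and leave it inside [e], take [f] with
    the fewest vertices outside [X].  If two or more were outside, then
    [X :|: f] would be a larger connected set, still 2-colourable: extend the
    colouring of [X] by using both colours on [f :\: X].  A hyperedge of
    [X :|: f] that is not inside [X] contains all of [f :\: X], by minimality
    if it meets [X]; if it does not meet [X], it is properly contained in [f],
    which a clutter forbids. *)
Lemma one_vertex_extension E W X e :
    is_clutter E -> connected_in E X -> two_colourable E X -> X \subset W ->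
    (forall Y, connected_in E Y -> two_colourable E Y -> Y \subset W ->
       X \subset Y -> Y = X) ->
    e \in E -> e \subset W -> splits X e ->
  exists f w, [/\ f \in E, w \in e :\: X, f :\: X = [set w]
                & f :&: X != set0].
Proof.
move=> clE cX /existsP[A /forall_inP Acol] XW Xmax eE eW spl.
pose p f := [&& f \in E, splits X f & f :\: X \subset e :\: X].
have pe : p e by apply/and3P.
case: (arg_minnP (fun f => #|f :\: X|) pe) => f /and3P[fE splf fe] fmin.
case/splitsP: (splf) => x [w [xf wf xX wX]].
have wD : w \in f :\: X by rewrite inE wX.
exists f, w; split=> //; first exact: (subsetP fe).
  2: by apply/set0Pn; exists x; rewrite inE xf.
apply/eqP; rewrite eq_sym eqEsubset sub1set wD /=.
apply/negPn/negP=> /subsetPn[z zD]; rewrite inE => zw.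
have /setP/(_ w) : X :|: f = X.
  apply: Xmax; rewrite ?subsetUl //.
  - exact: connectedU_edge xf xX.
  - (* [w] gets the first colour and [z], like the rest of [f :\: X], the
       second *)
    apply/existsP; exists ((A :&: X) :|: [set w]); apply/forall_inP=> g gE.
    apply/implyP=> gXf; have [gX|gX] := boolP (g \subset X).
      apply: splits_eq (implyP (Acol g gE) gX) => u /(subsetP gX) uX.
      rewrite !inE uX andbT; case: (altP eqP) => [uw|]; last by rewrite orbF.
      by rewrite -uw uX in wX.
    have gD : g :\: X \subset f :\: X.
      apply/subsetP=> u /setDP[/(subsetP gXf)/setUP[->//|uf] uX].
      by rewrite inE uX.
    have [g0|gX0] := eqVneq (g :&: X) set0.
      have gf : g \subset f.
        apply/subsetP=> u ug; have /(subsetP gD) : u \in g :\: X.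
          rewrite inE ug andbT; apply/negP=> uX.
          by have := in_set0 u; rewrite -g0 inE ug uX.
        by case/setDP.
      have gfE := clE _ _ gE fE gf; have := in_set0 x.
      by rewrite -g0 inE gfE xf xX.
    have /eqP gfD : g :\: X == f :\: X.
      rewrite eqEcard gD /=; apply: fmin; apply/and3P; split=> //.
        by rewrite /splits gX0.
      exact: subset_trans gD fe.
    have wg : w \in g :\: X by rewrite gfD.
    have zg : z \in g :\: X by rewrite gfD.
    case/setDP: wg zg => wg _ /setDP[zg zX].
    by apply/splitsP; exists w, z; rewrite !inE eqxx orbT (negPf zX) andbF.
  - rewrite subUset XW /=; apply/subsetP=> u uf.
    have [/(subsetP XW)//|uX] := boolP (u \in X).
    have : u \in f :\: X by rewrite inE uX.
    by move/(subsetP fe)/setDP=> [/(subsetP eW)].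
by rewrite inE wf orbT (negPf wX).
Qed.

Lemma maximal_connected_two_colourable E W w :
    (forall e, e \in E -> 1 < #|e|) -> w \in W ->
  exists X, [/\ connected_in E X, two_colourable E X, X \subset W &
    forall Y, connected_in E Y -> two_colourable E Y -> Y \subset W ->
      X \subset Y -> Y = X].
Proof.
move=> E2 wW.
pose p X := [&& connected_in E X, two_colourable E X & X \subset W].
have pw : p [set w].
  rewrite /p connected_set1 sub1set wW andbT /=; apply/existsP; exists set0.
  apply/forall_inP=> f fE; apply/implyP=> /subset_leq_card.
  by rewrite cards1 leqNgt E2.
case: (arg_maxnP (fun X => #|X|) pw) => X /and3P[cX tX XW] Xmax.
exists X; split=> // Y cY tY YW XY; apply/eqP.
rewrite eq_sym eqEcard XY /=; apply: Xmax; exact/and3P.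
Qed.

(** Greedy: split off a maximal connected 2-colourable subset [X] of [W] and
    continue with [W :\: X].  The hyperedges meeting both [X] and its complement
    are the only new ones, and they are handled by [one_vertex_extension]. *)
Lemma partition_two_colourable E W :
    is_clutter E -> (forall e, e \in E -> 1 < #|e|) ->
  exists P A, two_colourable_partition E W P A.
Proof.
move=> clE E2; have [n] := ubnP #|W|; elim: n W => // n IH W.
rewrite ltnS => Wn; have [->|/set0Pn[w wW]] := eqVneq W set0.
  exists set0, set0; split=> [||X|e eE].
  - by rewrite /cover big_set0.
  - by apply/trivIsetP=> X Y; rewrite inE.
  - by rewrite inE.
  - by rewrite subset0 => /eqP e0; have := E2 e eE; rewrite e0 cards0.
have [X [cX tX XW Xmax]] := maximal_connected_two_colourable E2 wW.
have [x xX] := connected_nonempty cX.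
have ltWX : #|W :\: X| < n.
  apply: leq_trans Wn; apply: proper_card; apply/properP; split.
    exact: subsetDl.
  by exists x; rewrite ?(subsetP XW) // inE xX.
have [P [A [covP trP cP AP]]] := IH _ ltWX.
have notX Y y : Y \in P -> y \in Y -> y \in W :\: X.
  by move=> YP yY; rewrite -covP; apply/bigcupP; exists Y.
have disX Y : Y \in P -> [disjoint X & Y].
  move=> YP; rewrite disjoint_sym; apply/pred0P=> y /=; apply/negbTE/negP.
  by case/andP=> /(notX _ _ YP)/setDP[_ /negPf->].
have XP : X \notin P.
  by apply/negP=> /notX/(_ xX)/setDP[_]; rewrite xX.
case/existsP: (tX) => A0 /forall_inP A0P.
exists (X |: P), ((A0 :&: X) :|: (A :\: X)); split.
- rewrite /cover big_setU1 //= -/(cover P) covP; apply/setP=> u.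
  by rewrite !inE; case: (boolP (u \in X)) => //= /(subsetP XW) ->.
- apply/trivIsetP=> Y Z; rewrite !inE => /orP[/eqP->|YP] /orP[/eqP->|ZP].
  + by rewrite eqxx.
  + by move=> _; exact: disX.
  + by move=> _; rewrite disjoint_sym; exact: disX.
  + exact: (trivIsetP trP).
- by move=> Y /setU1P[->|/cP].
- move=> e eE eW; have [eX|eX] := boolP (e \subset X).
    left; apply: splits_eq (implyP (A0P e eE) eX) => u /(subsetP eX) uX.
    by rewrite !inE uX andbT /= orbF.
  have [e0|e0] := eqVneq (e :&: X) set0; last first.
    right; have spl : splits X e by apply/andP.
    have [f [v [fE veX fX f0]]] :=
      one_vertex_extension clE cX tX XW Xmax eE eW spl.
    have : v \in cover P.
      by rewrite covP; case/setDP: veX => /(subsetP eW) vW vX; rewrite inE vX.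
    case/bigcupP=> Y YP vY; exists X, Y; rewrite !inE eqxx YP orbT; split=> //.
    + by apply: contraNneq XP => ->.
    + apply/exists_inP; exists f => //; apply/and3P; split=> //.
        apply/subsetP=> u uf; rewrite inE; case uX: (u \in X) => //=.
        have : u \in f :\: X by rewrite inE uX.
        by rewrite fX inE => /eqP->.
      apply/set0Pn; exists v; rewrite inE vY andbT.
      by have : v \in f :\: X; [rewrite fX set11|case/setDP].
    + rewrite e0; apply/set0Pn; exists v; rewrite inE vY andbT.
      by case/setDP: veX.
  have eDX u : u \in e -> u \notin X.
    by move=> ue; apply/negP=> uX; have := in_set0 u; rewrite -e0 inE ue uX.
  have eWX : e \subset W :\: X.
    by apply/subsetP=> u ue; rewrite inE eDX // (subsetP eW).
  have [spl|[Y [Z [YP ZP YZ lYZ m]]]] := AP e eE eWX.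
    left; apply: splits_eq spl => u /eDX uX.
    by rewrite !inE (negPf uX) andbF.
  by right; exists Y, Z; rewrite !inE YP ZP !orbT.
Qed.

(** * Colouring the graph of parts *)

(** The branch sets of a minor of the graph of parts are unions of parts.
    Containing one part is what guarantees that any set linked to every part
    is linked to the branch set. *)
Definition supported P S : bool :=
  (S \subset cover P) && [exists X in P, X \subset S].

(** The members of [s] are the branch sets of a complete minor of order
    [size s].  A sequence lets a branch set be added by consing. *)
Definition model_in E P (s : seq {set T}) : bool :=
  all (fun S => connected_in E S && supported P S) s &&
  pairwise (fun S U => [disjoint S & U] && link E S U) s.

Definition separates_links E P (C : Type) (c : {set T} -> C) : Prop :=
  forall X Y, X \in P -> Y \in P -> X != Y -> link E X Y -> c X <> c Y.

Lemma model_inS E P Q s : P \subset Q -> model_in E P s -> model_in E Q s.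
Proof.
move=> PQ /andP[/allP sP pw]; rewrite /model_in pw andbT.
have cPQ : cover P \subset cover Q.
  apply/bigcupsP=> X XP; apply: bigcup_sup; exact: (subsetP PQ).
apply/allP=> S /sP /andP[-> /andP[Sc /exists_inP[X XP XS]]] /=.
rewrite /supported (subset_trans Sc cPQ); apply/exists_inP.
by exists X => //; exact: (subsetP PQ).
Qed.

Lemma disjoint_cover P B :
  (forall X, X \in P -> [disjoint B & X]) -> [disjoint B & cover P].
Proof.
move=> dP; apply/pred0P=> x /=; apply/negbTE/negP=> /andP[xB /bigcupP[X XP xX]].
by have /pred0P/(_ x)/= := dP X XP; rewrite xB xX.
Qed.

(** Here [B] is the union of the previous layers, empty at the start, and [b]
    the first bit reserved for the next layer, the set [N] of the parts linked
    to [B].  A [K_t] model in [N] together with [B] would be a [K_(t+1)] model,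
    so [N] can be coloured with the remaining [t] bits.  A part outside [N]
    linked to a part of [N] is linked to [B :|: cover N], hence belongs to the
    next layer, where the first bit is flipped.  When [N] is empty no remaining
    part is linked to [B], and a new layering starts from any of them. *)
Lemma layered_colouring E P t :
    trivIset P -> (forall X, X \in P -> connected_in E X) ->
    (forall Q, Q \subset P -> (exists2 s, size s = t & model_in E Q s) \/
       exists c : {set T} -> t.-tuple bool, separates_links E Q c) ->
    (forall s, size s = t.+1 -> ~ model_in E P s) ->
  forall Q B b, Q \subset P ->
    (B == set0) || (connected_in E B && supported P B) ->
    (forall X, X \in Q -> [disjoint B & X]) ->
  exists2 c : {set T} -> t.+1.-tuple bool, separates_links E Q c &
    forall X, X \in Q -> link E B X -> thead (c X) = b.
Proof.
move=> trP cP IHt noK Q; have [n] := ubnP #|Q|; elim: n Q => // n IH Q.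
rewrite ltnS => Qn B b QP HB dB.
pose N := [set X in Q | link E B X].
have NQ : N \subset Q by apply/subsetP=> X; rewrite inE => /andP[].
have [N0|/set0Pn[Z ZN]] := eqVneq N set0.
  have noB X : X \in Q -> link E B X -> False.
    by move=> XQ lX; have := in_set0 X; rewrite -N0 inE XQ lX.
  have [Q0|/set0Pn[X XQ]] := eqVneq Q set0.
    exists (fun=> [tuple of nseq t.+1 b]) => [X Y|X]; by rewrite Q0 inE.
  have XP := subsetP QP X XQ.
  have ltQ : #|Q :\ X| < n by move: Qn; rewrite (cardsD1 X Q) XQ.
  have suppX : (X == set0) || (connected_in E X && supported P X).
    rewrite cP //= /supported; apply/orP; right; apply/andP; split.
      exact: bigcup_sup XP.
    by apply/exists_inP; exists X.
  have disX Y : Y \in Q :\ X -> [disjoint X & Y].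
    case/setD1P=> YX YQ; apply: (trivIsetP trP) => //; last by rewrite eq_sym.
    exact: (subsetP QP).
  have [c col cX] := IH _ ltQ X (~~ b) (subset_trans (subD1set _ _) QP)
                       suppX disX.
  exists (fun Y => if Y == X then [tuple of nseq t.+1 b] else c Y); last first.
    by move=> Y YQ /noB -/(_ YQ).
  have colX Y : Y \in Q -> Y != X -> link E X Y ->
      c Y <> [tuple of nseq t.+1 b].
    move=> YQ YX lXY /(congr1 (fun u => thead u)).
    by rewrite cX ?inE ?YX //; case: (b).
  move=> Y Y' YQ Y'Q YY' l.
  case: (eqVneq Y X) => YX; case: (eqVneq Y' X) => Y'X.
  - by rewrite YX Y'X eqxx in YY'.
  - by apply/nesym/colX => //; rewrite -YX.
  - by apply: colX => //; rewrite link_sym -Y'X.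
  - by apply: col => //; rewrite !inE ?YX ?Y'X.
have {HB} /andP[cB sB] : connected_in E B && supported P B.
  case/orP: HB => // /eqP B0; move: ZN; rewrite inE => /andP[_].
  by case/linkP=> f [x [y [_ _]]]; rewrite B0 inE andbF.
have NP : N \subset P by exact: subset_trans QP.
have [[s st /andP[/allP sN pw]]|[d cold]] := IHt N NP.
  case: (noK (B :: s)) => /=; first by rewrite st.
  have /andP[sP _] : model_in E P s.
    by apply: model_inS NP _; rewrite /model_in pw andbT; apply/allP.
  rewrite /model_in /= cB sB sP pw !andbT /=.
  apply/allP=> S /sN /andP[_ /andP[Sc /exists_inP[X XN XS]]].
  have XQ := subsetP NQ X XN.
  apply/andP; split.
    apply: disjointWr Sc _; apply: disjoint_cover => Y YN.
    exact: dB (subsetP NQ Y YN).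
  by move: XN; rewrite inE => /andP[_]; apply: linkS.
have cN X : X \in N -> connected_in E X && link E B X.
  by rewrite inE => /andP[XQ ->]; rewrite cP // (subsetP QP).
pose B' := B :|: cover N.
have cB' : connected_in E B' by exact: connectedU_bigcup.
have sB' : supported P B'.
  case/andP: sB => BP /exists_inP[X XP XB]; apply/andP; split.
    rewrite subUset BP; apply/bigcupsP=> Y YN.
    by apply: bigcup_sup; exact: (subsetP NP).
  by apply/exists_inP; exists X => //; apply: subset_trans (subsetUl _ _).
have ltQ : #|Q :\: N| < n.
  apply: leq_trans Qn; apply: proper_card; apply/properP; split.
    exact: subsetDl.
  by exists Z; rewrite ?(subsetP NQ) // inE ZN.
have dB' X : X \in Q :\: N -> [disjoint B' & X].
  case/setDP=> XQ XN; rewrite -setI_eq0 setIUl setU_eq0 !setI_eq0.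
  rewrite dB //= disjoint_sym; apply: disjoint_cover => Y YN.
  apply: (trivIsetP trP); [exact: (subsetP QP)|exact: (subsetP NP)|].
  by apply: contraNneq XN => ->.
have [c col cB'P] := IH _ ltQ B' (~~ b) (subset_trans (subsetDl _ _) QP)
    (introT orP (or_intror (introT andP (conj cB' sB')))) dB'.
exists (fun X => if X \in N then [tuple of b :: d X] else c X); last first.
  by move=> X XQ lX; rewrite inE XQ lX /=.
have mix X Y : X \in N -> Y \in Q -> Y \notin N -> link E X Y ->
    [tuple of b :: d X] <> c Y.
  move=> XN YQ YN lXY /(congr1 (fun u => thead u)); rewrite theadE.
  rewrite cB'P; first by case: (b).
    by rewrite inE YN.
  apply: linkS lXY => //; apply: subset_trans (subsetUr _ _).
  exact: bigcup_sup.
move=> X Y XQ YQ XY l.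
case XN: (X \in N); case YN: (Y \in N).
- move=> /(congr1 (fun u : t.+1.-tuple bool => behead u)) /= /val_inj.
  exact: cold.
- by apply: mix; rewrite ?YN.
- by apply/nesym/mix; rewrite ?XN // link_sym.
- by apply: col; rewrite // inE ?XN ?YN.
Qed.

(** The graph case: a graph without a [K_t] minor is [2^t]-colourable.  The
    empty model settles [t = 0]. *)
Lemma model_or_colouring E P t :
    trivIset P -> (forall X, X \in P -> connected_in E X) ->
  (exists2 s, size s = t & model_in E P s) \/
  exists c : {set T} -> t.-tuple bool, separates_links E P c.
Proof.
elim: t P => [|t IH] P trP cP; first by left; exists [::].
have [ex|no] := boolp.pselect (exists2 s, size s = t.+1 & model_in E P s).
  by left.
have IHP Q : Q \subset P -> (exists2 s, size s = t & model_in E Q s) \/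
    exists c : {set T} -> t.-tuple bool, separates_links E Q c.
  move=> QP; apply: IH => [|X /(subsetP QP)/cP//].
  apply/trivIsetP=> X Y /(subsetP QP) XP /(subsetP QP) YP.
  exact: (trivIsetP trP).
have noP s : size s = t.+1 -> ~ model_in E P s.
  by move=> st sP; apply: no; exists s.
have dis0 X : X \in P -> [disjoint set0 & X].
  by move=> _; apply/pred0P=> x /=; rewrite inE.
have [|c col _] := layered_colouring trP cP IHP noP true (subxx P) _ dis0.
  by rewrite eqxx.
right; by exists c.
Qed.

End Connectivity.

(** * From branch sets to complete minors *)

Section Minors.
Set Implicit Arguments.
Unset Strict Implicit.
Unset Printing Implicit Defensive.

Definition branch_sets (H : hypergraph) (t : nat) (B : 'I_t -> {set H}) :=
  (forall i, connected_in (hyperedges H) (B i)) /\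
  (forall i j, i != j ->
     [disjoint B i & B j] && link (hyperedges H) (B i) (B j)).

Lemma obtained_trans (H1 H2 H3 : hypergraph) :
  obtained_from H1 H2 -> obtained_from H2 H3 -> obtained_from H1 H3.
Proof.
move=> H12; elim=> [//|G W F _ /obtained_sub|G e _ IH eG]; first exact.
exact: obtained_contract.
Qed.

Lemma minor_obtained (H1 H2 H3 : hypergraph) :
  obtained_from H1 H2 -> minor H3 H2 -> minor H3 H1.
Proof.
by move=> H12 [G H2G iso]; exists G => //; exact: obtained_trans H2G.
Qed.

Section Contraction.

Variables (H : hypergraph) (e : {set H}).
Hypothesis eH : e \in hyperedges H.

Let phi : H -> contract e := contract_map e.

Lemma contract_map_None (x : H) : (contract_map e x == None) = (x \in e).
Proof.
by rewrite /contract_map; case: insubP => [u /negPf-> _|/negbNE->].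
Qed.

Lemma contract_map_Some (x : H) (u : {x : H | x \notin e}) :
  (contract_map e x == Some u) = (x == val u).
Proof.
rewrite /contract_map; case: insubP => [v _ <-|/negbNE xe]; first by [].
by apply/esym/negbTE; apply: contraL xe => /eqP->; exact: (valP u).
Qed.

Lemma contract_map_surj (y : contract e) : exists x : H, phi x = y.
Proof.
case: y => [u|]; first by exists (val u); apply/eqP; rewrite contract_map_Some.
have /card_gt0P[x xe] : 0 < #|e| by exact: ltnW (hyperedge_size eH).
by exists x; apply/eqP; rewrite contract_map_None.
Qed.

Lemma contract_map_fibre (x y : H) :
  phi x = phi y -> x = y \/ (x \in e) && (y \in e).
Proof.
case E: (phi y) => [u|] /eqP.
  by rewrite contract_map_Some; move/eqP: E; rewrite contract_map_Some;
    move=> /eqP-> /eqP->; left.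
by rewrite contract_map_None; move/eqP: E; rewrite contract_map_None;
  move=> -> ->; right.
Qed.

(** When [e] lies in one of several disjoint branch sets, all of them satisfy
    the hypothesis and so are recovered from their images in the contraction. *)
Lemma preim_contract_map (B : {set H}) :
  (e \subset B) || [disjoint e & B] -> phi @^-1: (phi @: B) = B.
Proof.
move=> eB; apply/setP=> x; rewrite inE; apply/imsetP/idP; last by exists x.
case=> y yB /contract_map_fibre[->//|/andP[xe ye]].
case/orP: eB => [/subsetP|/pred0P/(_ y)/=]; first exact.
by rewrite ye yB.
Qed.

Lemma contract_hyperedge (f : {set H}) :
    f \in hyperedges H -> ~~ (f \subset e) ->
  phi @: f \in hyperedges (contract e).
Proof. by move=> fH fe; apply/imsetP; exists f; rewrite // inE fH. Qed.

Lemma connected_contract (X : {set contract e}) :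
    connected_in (hyperedges H) (phi @^-1: X) ->
  connected_in (hyperedges (contract e)) X.
Proof.
move=> cX; apply/andP; split.
  have [x] := connected_nonempty cX; rewrite inE => xX.
  by apply/set0Pn; exists (phi x).
apply/forallP=> S; apply/implyP=> /splitsP[u [v [uX vX uS vS]]].
have [x xu] := contract_map_surj u; have [y yv] := contract_map_surj v.
have [||||f fH /andP[fX /splitsP[a [b [af bf aS bS]]]]] :=
    connected_edge (S := phi @^-1: S) (x := x) (y := y) cX;
  rewrite ?inE ?xu ?yv //.
rewrite !inE in aS bS.
apply/exists_inP; exists (phi @: f).
  apply: contract_hyperedge => //; apply/negP=> /subsetP fe.
  move/fe: af; move/fe: bf; rewrite -!contract_map_None => /eqP b0 /eqP a0.
  by move: aS bS; rewrite /phi a0 b0 => ->.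
apply/andP; split.
  by apply/subsetP=> _ /imsetP[z /(subsetP fX) + ->]; rewrite inE.
by apply/splitsP; exists (phi a), (phi b); rewrite !imset_f.
Qed.

(** The hyperedge forming the link survives the contraction: were it contained
    in [e], its image would be a single vertex common to [S] and [U]. *)
Lemma link_contract (S U : {set contract e}) :
    [disjoint S & U] -> link (hyperedges H) (phi @^-1: S) (phi @^-1: U) ->
  link (hyperedges (contract e)) S U.
Proof.
move=> dSU /linkP[f [x [y [fH fSU /andP[xf xS] /andP[yf yU]]]]].
rewrite !inE in xS yU.
apply/linkP; exists (phi @: f), (phi x), (phi y); split.
- apply: contract_hyperedge => //; apply/negP=> /subsetP fe.
  move/fe: xf; move/fe: yf; rewrite -!contract_map_None => /eqP y0 /eqP x0.
  have /pred0P/(_ (phi x))/= := dSU.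
  by rewrite xS /phi x0 -y0 yU.
- apply/subsetP=> _ /imsetP[z /(subsetP fSU) + ->].
  by rewrite !inE.
- by rewrite imset_f.
- by rewrite imset_f.
Qed.

Lemma card_contract : #|contract e| < #|H|.
Proof.
rewrite card_option card_sig -(cardC (mem e)).
have -> : #|[pred x | x \notin e]| = #|[predC e]| by exact: eq_card.
by rewrite -[#|[predC e]|.+1]add1n ltn_add2r (hyperedge_size eH).
Qed.

Lemma branch_sets_contract t (B : 'I_t -> {set H}) i :
    branch_sets B -> e \subset B i ->
  branch_sets (fun j => phi @: B j : {set contract e}).
Proof.
move=> [cB lB] eB.
have preB j : phi @^-1: (phi @: B j) = B j.
  apply: preim_contract_map; have [->|ij] := eqVneq j i; first by rewrite eB.
  apply/orP; right; apply: disjointWl eB _.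
  by have /andP[] : _ := lB i j (contra_neq esym ij).
split=> [j|j k jk]; first by apply: connected_contract; rewrite preB.
have /andP[djk ljk] := lB j k jk.
have dis : [disjoint phi @: B j & phi @: B k].
  apply/pred0P=> y /=; apply/negbTE/negP=> /andP[].
  have [x <-] := contract_map_surj y => xj xk.
  have /pred0P/(_ x)/= := djk; rewrite -(preB j) -(preB k) !inE.
  by rewrite xj xk.
by rewrite dis; apply: link_contract; rewrite ?preB.
Qed.

End Contraction.

(** With singletons as branch sets the links are edges of size 2; all that is
    left is to delete the other vertices and the larger hyperedges. *)
Lemma minor_singletons (H : hypergraph) t (r : 'I_t -> H) :
  branch_sets (fun i => [set r i]) -> minor (K t) H.
Proof.
move=> [_ lr].
have r_inj : injective r.
  move=> i j rij; apply/eqP; apply: contraT => /lr.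
  by rewrite rij => /andP[/pred0P/(_ (r j))/=]; rewrite inE eqxx.
pose W := [set r i | i in 'I_t]; pose F := [set f : {set H} | #|f| == 2].
have rW i : r i \in W by rewrite imset_f.
pose f i : {x : H | x \in W} := Sub (r i) (rW i).
have f_inj : injective f by move=> i j /(congr1 val)/= /r_inj.
exists (subhypergraph W F); first by apply: obtained_sub; exact: obtained_refl.
exists f.
  apply: inj_card_bij => //.
  by rewrite card_sig -[X in X <= _]/#|W| card_imset.
move=> e; rewrite !inE -imset_comp card_imset; last exact: r_inj.
case e2: (#|e| == 2) => //=; have /cards2P[i [j [ij ->]]] := e2.
have -> : (val \o f) @: [set i; j] = [set r i; r j].
  by rewrite imsetU !imset_set1.
have /andP[_ /linkP[g [x [y [gH]]]]] := lr i j ij.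
rewrite !inE => gsub /andP[xg /eqP xi] /andP[yg /eqP yj].
suff <- : g = [set r i; r j] by [].
by apply/eqP; rewrite eqEsubset gsub subUset !sub1set -xi -yj xg.
Qed.

(** A branch set with two vertices contains a hyperedge, by connectedness;
    contract it and argue by induction on the number of vertices. *)
Lemma minor_branch_sets (H : hypergraph) t (B : 'I_t -> {set H}) :
  branch_sets B -> minor (K t) H.
Proof.
have [n] := ubnP #|H|; elim: n H B => // n IH H B.
rewrite ltnS => Hn [cB lB].
have [/forallP B1|] := boolP [forall i, #|B i| == 1].
  have inB i : {x | B i == [set x]}.
    by apply: sigW; have /cards1P[x ->] := B1 i; exists x.
  apply: (@minor_singletons _ _ (fun i => sval (inB i))); split=> [i|i j ij].
    exact: connected_set1.
  by rewrite -(eqP (svalP (inB i))) -(eqP (svalP (inB j))) lB.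
rewrite negb_forall => /existsP[i Bi].
have [x xB] := connected_nonempty (cB i).
have [y yB yx] : exists2 y, y \in B i & y \notin [set x].
  apply/subsetPn; apply: contra Bi => sBx.
  by rewrite eqn_leq card_gt0 -{1}(cards1 x) subset_leq_card //=;
    apply/set0Pn; exists x.
have [e eH /andP[eB _]] := connected_edge (cB i) xB yB (set11 x) yx.
apply: (@minor_obtained H (contract e)).
  by apply: obtained_contract => //; exact: obtained_refl.
apply: IH (branch_sets_contract eH (conj cB lB) eB).
exact: leq_trans (card_contract eH) Hn.
Qed.

Lemma minor_model (H : hypergraph) (P : {set {set H}}) s :
  model_in (hyperedges H) P s -> minor (K (size s)) H.
Proof.
case/andP=> /allP sP /(pairwiseP set0) pw.
apply: (@minor_branch_sets H _ (fun i => nth set0 s i)); split=> [i|i j].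
  by have /andP[] := sP _ (mem_nth set0 (ltn_ord i)).
rewrite neq_ltn => /orP[] ij; first by apply: pw; rewrite ?inE.
by rewrite disjoint_sym link_sym; apply: pw; rewrite ?inE.
Qed.

(** * Hypergraphs without a complete minor have bounded chromatic number *)

Lemma colorable_by (H : hypergraph) (S : finType) (c : H -> S) :
  (forall e, e \in hyperedges H ->
     exists x y, [/\ x \in e, y \in e & c x != c y]) ->
  colorable H #|S|.
Proof.
move=> cP; apply/existsP; exists [ffun x => enum_rank (c x)].
apply/forallP=> s; apply/forall_inP=> e /cP[x [y [xe ye]]].
apply: contraNN => /subsetP sub_e; apply/eqP/enum_rank_inj.
move: (sub_e x xe) (sub_e y ye); rewrite !inE !ffunE => /eqP-> /eqP->.
by [].
Qed.

Lemma chromatic_number_min (H : hypergraph) k :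
  colorable H k -> chromatic_number H <= k.
Proof. by rewrite /chromatic_number; case: ex_minnP => m _; apply. Qed.

Lemma chromatic_number_colorable (H : hypergraph) :
  colorable H (chromatic_number H).
Proof. by rewrite /chromatic_number; case: ex_minnP. Qed.

Lemma chromatic_number_bound (H : hypergraph) t :
  ~ minor (K t) H -> chromatic_number H <= 2 * 2 ^ t.
Proof.
move=> noK.
(* minimal hyperedges form a clutter, and every hyperedge contains one *)
pose E := [set e | minset (mem (hyperedges H)) e].
have EH : E \subset hyperedges H.
  by apply/subsetP=> e; rewrite inE => /minsetp.
have clE : is_clutter E.
  move=> e f; rewrite !inE => eM fM ef; apply: minsetinf fM _ ef.
  exact: minsetp eM.
have E2 e : e \in E -> 1 < #|e| by move/(subsetP EH); exact: hyperedge_size.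
have [P [A [covP trP cP AP]]] := partition_two_colourable setT clE E2.
have [[s st sP]|[d dP]] := model_or_colouring t trP cP.
  case: noK; rewrite -st; apply: (@minor_model H P).
  case/andP: sP => /allP sP pw; apply/andP; split.
    by apply/allP=> S /sP /andP[/(connectedS EH)-> ->].
  apply: sub_pairwise pw => S U /andP[->]; exact: linkS.
pose c (x : H) := (x \in A, d (pblock P x)).
have -> : 2 * 2 ^ t = #|{: bool * t.-tuple bool}|.
  by rewrite card_prod card_tuple card_bool.
apply/chromatic_number_min/(colorable_by (c := c)) => e eH.
have [f fM fe] := minset_exists (P := mem (hyperedges H)) eH.
have fE : f \in E by rewrite inE.
have [/splitsP[x [y [xf yf xA yA]]]|] := AP f fE (subsetT f).
  exists x, y; rewrite !(subsetP fe) //; split=> //.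
  by rewrite xpair_eqE xA (negPf yA).
move=> [X [Y [XP YP XY lXY /andP[/set0Pn[x + ] /set0Pn[y]]]]].
rewrite !inE => /andP[xf xX] /andP[yf yY].
exists x, y; rewrite !(subsetP fe) //; split=> //.
rewrite /c (def_pblock trP XP xX) (def_pblock trP YP yY) xpair_eqE negb_and.
by apply/orP; right; apply/eqP; exact: dP.
Qed.

(** The set of chromatic numbers in question is nonempty and bounded, hence has
    a maximum, and [h t] is a genuine value rather than the default 0. *)
Lemma h_is_largest t (H0 : hypergraph) :
  ~ minor (K t) H0 -> is_largest_chromatic_number t (h t).
Proof.
move=> noK0; apply: (@classical_sets.xgetPex _ 0).
pose p m := boolp.asbool
  (exists2 H : hypergraph, ~ minor (K t) H & chromatic_number H = m).
have exp : exists m, p m.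
  by exists (chromatic_number H0); apply/boolp.asboolP; exists H0.
have leb m : p m -> m <= 2 * 2 ^ t.
  by move/boolp.asboolP=> [H noK <-]; exact: chromatic_number_bound.
case: (ex_maxnP exp leb) => m /boolp.asboolP pm max; exists m; split=> // H noK.
by apply: max; apply/boolp.asboolP; exists H.
Qed.

(** * Complete uniform hypergraphs *)

(** In a hypergraph obtained from one with [n] vertices and hyperedges of size
    at least [r], the weight of a vertex is the number of original vertices
    merged into it. *)
Definition weighting (r n : nat) (H : hypergraph) (w : H -> nat) : Prop :=
  [/\ \sum_x w x <= n, forall x, w x = 1 \/ r <= w x &
      forall e, e \in hyperedges H -> r <= \sum_(x in e) w x].

(** A contraction adds up the weights over each fibre of the contraction map:
    sums of weights over preimages are unchanged, and the only new weight is
    that of the contracted hyperedge, at least [r]. *)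
Lemma obtained_weighting (r : nat) (H G : hypergraph) :
    (forall e, e \in hyperedges H -> r <= #|e|) -> obtained_from H G ->
  exists w, weighting r #|H| (H := G) w.
Proof.
move=> Hr; elim=> [|{}G W F _ [w [wn w1 wE]]|{}G e _ [w [wn w1 wE]] eG].
- exists (fun=> 1); split=> [|x|e /Hr]; first by rewrite sum1_card.
    by left.
  by rewrite sum1_card.
- have sum_val (f : {set {x : G | x \in W}}) :
      \sum_(x in f) w (val x) = \sum_(x in val @: f) w x.
    by rewrite big_imset //= => x y _ _; exact: val_inj.
  exists (fun x => w (val x)); split=> [|x|f]; last 1 first.
  + by rewrite inE sum_val => /setIP[_ /wE].
  + apply: leq_trans wn; have := sum_val setT.
    rewrite (eq_bigl predT) => [->|x]; last by rewrite inE.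
    rewrite [leqRHS](bigID (fun x => x \in val @: [set: {x : G | x \in W}])).
    exact: leq_addr.
  + exact: w1.
- pose phi : G -> contract e := contract_map e.
  exists (fun y => \sum_(x | phi x == y) w x); split=> [|[u|]|f].
  + apply: leq_trans wn; rewrite [leqRHS](partition_big phi predT) //.
  + rewrite (big_pred1 (val u)) => [|x]; first exact: w1.
    exact: contract_map_Some.
  + right; rewrite (eq_bigl (fun x => x \in e)) => [|x]; first exact: wE.
    exact: contract_map_None.
  + case/imsetP=> g; rewrite inE => /andP[gG _] ->.
    apply: leq_trans (wE g gG) _.
    rewrite [leqLHS](partition_big phi (fun y => y \in phi @: g)).
      apply: leq_sum => y _; rewrite [leqRHS](bigID (fun x => x \in g)) /=.
      by rewrite (eq_bigl _ _ (fun x => andbC _ _)) leq_addr.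
    by move=> x xg; exact: imset_f.
Qed.

(** Two vertices of weight 1 would span an edge of weight [2 < r], so all but
    at most one of the [t.+1] vertices have weight at least [r]. *)
Lemma complete_minor_order (r t : nat) (H : hypergraph) :
    2 < r -> (forall e, e \in hyperedges H -> r <= #|e|) ->
  minor (K t.+1) H -> r * t < #|H|.
Proof.
move=> r2 Hr [G /(obtained_weighting Hr)[w [wn w1 wE]] [f f_bij fE]].
apply: leq_trans wn; rewrite (reindex f) /=; last exact: onW_bij.
have f_inj := bij_inj f_bij.
have pair i j : i != j -> r <= w (f i) + w (f j).
  move=> ij; have /wE : f @: [set i; j] \in hyperedges G.
    by rewrite fE inE cards2 ij.
  rewrite big_imset /=; last by move=> ? ? _ _; exact: f_inj.
  by rewrite big_setU1 ?inE //= big_set1.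
have [/existsP[i /eqP wi]|] := boolP [exists i, w (f i) == 1].
  rewrite (bigD1 i) //= wi add1n ltnS.
  have <- : \sum_(j < t.+1 | j != i) r = r * t.
    by rewrite sum_nat_const cardC1 card_ord mulnC.
  apply: leq_sum => j ji; have := pair j i ji; rewrite wi.
  by case: (w1 (f j)) => [->|//]; lia.
rewrite negb_exists => /forallP w_neq1.
apply: (@leq_trans (\sum_(i < t.+1) r)).
  by rewrite sum_nat_const card_ord; nia.
apply: leq_sum => i _; case: (w1 (f i)) => // wi.
by have := w_neq1 i; rewrite wi.
Qed.

(** In the complete hypergraph of rank [s.+1] a set is independent exactly when
    it has at most [s] vertices; consecutive blocks of length [s] give an
    optimal colouring. *)
Lemma colorable_complete (s n k : nat) (s_gt0 : 1 < s.+1) :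
  colorable (complete_hypergraph s_gt0 n) k = (n <= s * k).
Proof.
apply/existsP/idP => [[c /forallP cP]|nk].
  have fib j : #|[set x | c x == j]| <= s.
    rewrite leqNgt; apply/negP=> /card_geqP[l [ul sl lsub]].
    have /forall_inP/(_ [set x in l]) := cP j; rewrite inE cardsE.
    move/card_uniqP: (ul) ->; rewrite sl eqxx => /(_ isT)/negP; apply.
    by apply/subsetP=> x; rewrite inE => /lsub.
  rewrite -[leqLHS]card_ord -sum1_card (partition_big c predT) //=.
  apply: (@leq_trans (\sum_(j < k) s)).
    by apply: leq_sum => j _; rewrite sum1dep_card.
  by rewrite sum_nat_const card_ord mulnC.
have lt_div (x : 'I_n) : x %/ s < k.
  by rewrite ltn_divLR // mulnC; exact: leq_trans nk.
exists [ffun x => Ordinal (lt_div x)].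
apply/forallP=> j; apply/forall_inP=> e; rewrite inE => /eqP es.
apply/negP=> /subsetP ej.
suff : #|e| <= s by rewrite es ltnn.
(* vertices of the same colour are told apart by their place in the block *)
pose m (x : 'I_n) : 'I_s := Ordinal (ltn_pmod x s_gt0).
rewrite -(@card_in_imset _ _ m).
  by rewrite -[leqRHS]card_ord; exact: max_card.
move=> x y /ej + /ej; rewrite !inE !ffunE => /eqP/(congr1 val)/= xj.
move=> /eqP/(congr1 val)/= yj [] xy; apply: val_inj.
by rewrite /= (divn_eq x s) (divn_eq y s) xj yj xy.
Qed.

End Minors.

Import Order.TTheory GRing.Theory Num.Theory.
Local Open Scope ring_scope.

Theorem mainTheorem4 (t : nat) (ht : (2 <= t)%N) :
  [/\ ~ minor (K t) (K3 (3 * (t - 1))%N),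
      (chromatic_number (K3 (3 * (t - 1))%N))%:Z
        = Num.ceil (3 / 2 * (t%:R - 1) : rat)
    & Num.ceil (3 / 2 * (t%:R - 1) : rat) <= (h t)%:Z].
Proof.
case: t ht => // t _; rewrite subn1 /=.
have noK : ~ minor (K t.+1) (K3 (3 * t)).
  move=> /(@complete_minor_order 3) lt3.
  suff : (3 * t < 3 * t)%N by rewrite ltnn.
  rewrite -[ltnRHS]card_ord; apply: lt3 => // e.
  by rewrite inE => /eqP->.
have chi : (chromatic_number (K3 (3 * t)))%:Z
    = Num.ceil (3 / 2 * (t.+1%:R - 1) : rat).
  set k := chromatic_number _.
  have k_le : (3 * t <= 2 * k)%N.
    by rewrite -(@colorable_complete 2 _ _ isT) chromatic_number_colorable.
  have k_min j : (3 * t <= 2 * j)%N -> (k <= j)%N.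
    by rewrite -(@colorable_complete 2 _ _ isT); exact: chromatic_number_min.
  apply/esym/ceil_def/andP; split; last first.
    by move: k_le; rewrite -(ler_nat rat) -(pmulrn 1 k) -natr1; lra.
  have : (2 * k < 3 * t + 2)%N.
    rewrite ltnNge; apply/negP=> k_big; have := k_min k.-1; lia.
  by rewrite -(ltr_nat rat) rmorphB /= -(pmulrn 1 k) -natr1; lra.
split=> //; rewrite -chi lez_nat.
have [_ max] := h_is_largest noK.
exact: max.
Qed.
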